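(* Let $H\in(0,1)$, let $(a,b)\in\mathbb{R}^2\setminus\{(0,0)\}$, and let $Z^H=(Z_t^H(a,b))_{t\ge 0}$ be the generalized fractional Brownian motion with parameters $a,b,H$. Then: (i) $Z^H$ is a centered Gaussian process. (ii) For all $s\ge 0$ and $t\ge 0$, $$\operatorname{Cov}\bigl(Z_t^H(a,b),Z_s^H(a,b)\bigr)=\tfrac12 (a+b)^2\bigl(s^{2H}+t^{2H}\bigr)-ab\,(t+s)^{2H}-\tfrac{a^2+b^2}{2}\,|t-s|^{2H}.$$ (iii) For all $t\ge 0$, $$E\bigl(Z_t^H(a,b)^2\bigr)=\bigl(a^2+b^2-(2^{2H}-2)ab\bigr)\,t^{2H}.$$
   Context: For $H\in(0,1)$, a two-sided fractional Brownian motion with Hurst parameter $H$ is a centered Gaussian process $B^H=(B_t^H)_{t\in\mathbb{R}}$ on a probability space $(\Omega,F,\mathbb{P})$ with covariance $\operatorname{Cov}(B_t^H,B_s^H)=\frac12\bigl(|s|^{2H}+|t|^{2H}-|t-s|^{2H}\bigr)$ for $s,t\in\mathbb{R}$. For real $a,b$ with $(a,b)\ne(0,0)$, the generalized fractional Brownian motion (gfBm) with parameters $a,b,H$ is the process $Z^H=(Z_t^H)_{t\ge0}$ defined by $Z_t^H=Z_t^H(a,b)=aB_t^H+bB_{-t}^H$ for $t\ge 0$. *)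

(* Defs.v *)
From HB Require Import structures.
From mathcomp Require Import all_boot all_order all_algebra.
From mathcomp Require Import all_classical all_reals all_analysis.
From mathcomp Require Import measurable_realfun.

Set Implicit Arguments.
Unset Strict Implicit.
Unset Printing Implicit Defensive.

Import Order.TTheory GRing.Theory Num.Theory.
Import numFieldNormedType.Exports.

Local Open Scope classical_set_scope.
Local Open Scope ring_scope.

(* The degenerate case is handled separately because [normal_prob m 0] is, by
   a totality convention of the library, the uniform law on [0, 1] and not the
   point mass at [m]. *)
Definition gaussian_law (R : realType) (m s : R) : set R -> \bar R :=
  if s == 0 then \d_m else normal_prob m s.

(* Laws are compared on measurable sets only. *)
Definition gaussian_rv d (T : measurableType d) (R : realType)
    (P : probability T R) (X : {RV P >-> R}) : Prop :=
  exists m s : R, 0 <= s /\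
    forall A : set R, measurable A -> distribution P X A = gaussian_law m s A.

(* A family of random variables indexed by [I] all of whose finite linear
   combinations are (possibly degenerate) Gaussian random variables. *)
Definition gaussian_process d (T : measurableType d) (R : realType)
    (P : probability T R) (I : Type) (X : I -> {RV P >-> R}) : Prop :=
  forall (n : nat) (c : 'I_n -> R) (t : 'I_n -> I),
    gaussian_rv (\sum_(i < n) c i *: X (t i) : {RV P >-> R}).

Definition centered_process d (T : measurableType d) (R : realType)
    (P : probability T R) (I : Type) (X : I -> {RV P >-> R}) : Prop :=
  forall t : I, ('E_P[X t] = 0)%E.

Definition two_sided_fBm d (T : measurableType d) (R : realType)
    (P : probability T R) (H : R) (B : R -> {RV P >-> R}) : Prop :=
  [/\ gaussian_process B,
      centered_process B &
      forall s t : R, covariance P (B t) (B s) =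
        (2^-1 * (`|s| `^ (2 * H) + `|t| `^ (2 * H)
                 - `|t - s| `^ (2 * H)))%:E].

Definition gfBm d (T : measurableType d) (R : realType) (P : probability T R)
    (a b : R) (B : R -> {RV P >-> R}) (t : {nonneg R}) : {RV P >-> R} :=
  a *: B t%:num + b *: B (- t%:num).

(* Main.v *)
(* Square integrability of [B_t], which makes covariance bilinear, needs no
   Gaussian moment: [B_t] is centered, so [E (B_t ^ 2)] is the covariance of
   [B_t] with itself, which is finite by hypothesis. *)
Require Import Defs.
From HB Require Import structures.
From mathcomp Require Import all_boot all_order all_algebra.
From mathcomp Require Import all_classical all_reals all_analysis.
From mathcomp Require Import measurable_realfun.
From mathcomp Require Import ring.

Set Implicit Arguments.
Unset Strict Implicit.
Unset Printing Implicit Defensive.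

Import Order.TTheory GRing.Theory Num.Theory.
Import numFieldNormedType.Exports.

Local Open Scope classical_set_scope.
Local Open Scope ring_scope.

(** A combination of [n] values of the new process is a combination of [n + n] values of [X]: the
    first half of the indices carries the weights [c k * a] at [u], the second half [c k * b] at
    [v]. *)
Lemma gaussian_process_comb (R : realType) (d : measure_display)
    (T : measurableType d) (P : probability T R) (I J : Type)
    (X : I -> {RV P >-> R}) (a b : R) (u v : J -> I) :
  gaussian_process X ->
  gaussian_process (fun j => a *: X (u j) + b *: X (v j) : {RV P >-> R}).
Proof.
move=> gX n c t.
have := gX (n + n)%N
  (fun i => match fintype.split i with inl k => c k * a | inr k => c k * b end)
  (fun i => match fintype.split i with inl k => u (t k) | inr k => v (t k) end).
rewrite big_split_ord/=.
(* The shifted indices left by [big_split_ord] are by definition images of [unsplit], so each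
   [match] reduces to its own branch. *)
under eq_bigr do rewrite (unsplitK (inl _)).
under [X in _ + X]eq_bigr do rewrite (unsplitK (inr _)).
rewrite -big_split/=.
by under eq_bigr do rewrite -!scalerA -scalerDr.
Qed.

Lemma covariance_centered (R : realType) (d : measure_display)
    (T : measurableType d) (P : probability T R) (X Y : T -> R) :
  ('E_P[X] = 0 -> 'E_P[Y] = 0 -> covariance P X Y = 'E_P[X \* Y])%E.
Proof.
move=> EX0 EY0; rewrite unlock EX0 EY0; congr expectation.
by apply/funext => w /=; rewrite fctE /= !subr0.
Qed.

Lemma sqr_integrable_Lfun2 (R : realType) (d : measure_display)
    (T : measurableType d) (P : probability T R) (X : {RV P >-> R}) :
  ('E_P[X \* X] < +oo)%E -> (X : T -> R) \in Lfun P 2%:E.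
Proof.
rewrite unlock => EX2; rewrite inE; apply/andP; split; rewrite inE//=.
rewrite /finite_norm unlock poweR_lty//.
(* The norm uses a real power of the absolute value; with exponent 2 it is a natural power, and the
   absolute value disappears. *)
under eq_integral do rewrite /= powR_mulrn// real_normK ?num_real// expr2.
exact: EX2.
Qed.

Lemma expectation_comb (R : realType) (d : measure_display)
    (T : measurableType d) (P : probability T R) (a b : R) (X Y : T -> R) :
  X \in Lfun P 1 -> Y \in Lfun P 1 ->
  ('E_P[fun w => (a * X w + b * Y w)%R] = a%:E * 'E_P[X] + b%:E * 'E_P[Y])%E.
Proof.
move=> X1 Y1.
rewrite -!expectationZl// -expectationD ?Lfun_scale//.
by congr expectation; apply/funext => w /=; rewrite ![_ * a]mulrC ![_ * b]mulrC.
Qed.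

(** Square integrability puts the four products in L1. The right side stays nested so that three
    uses of [expectation_comb] fold it into one expectation. *)
Lemma expectation_mul_comb (R : realType) (d : measure_display)
    (T : measurableType d) (P : probability T R) (a b : R) (X Y U V : T -> R) :
  X \in Lfun P 2%:E -> Y \in Lfun P 2%:E ->
  U \in Lfun P 2%:E -> V \in Lfun P 2%:E ->
  ('E_P[fun w => ((a * X w + b * Y w) * (a * U w + b * V w))%R] =
   a%:E * (a%:E * 'E_P[X \* U] + b%:E * 'E_P[X \* V]) +
   b%:E * (a%:E * 'E_P[Y \* U] + b%:E * 'E_P[Y \* V]))%E.
Proof.
move=> X2 Y2 U2 V2.
have comb1 (f g : T -> R) : f \in Lfun P 1 -> g \in Lfun P 1 ->
    (fun w => a * f w + b * g w) \in Lfun P 1.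
  move=> f1 g1.
  rewrite (_ : (fun w => _) = (a \o* f) + (b \o* g)) ?rpredD ?Lfun_scale//.
  by apply/funext => w; rewrite fctE /= mulrC [b * _]mulrC.
have mul1 := @Lfun2_mul_Lfun1 _ _ _ P.
rewrite -!(expectation_comb a b) ?comb1 ?mul1//.
by congr expectation; apply/funext => w /=; ring.
Qed.

Section two_sided_fBm_moments.
Context (R : realType) (d : measure_display) (T : measurableType d).
Variables (P : probability T R) (H : R) (B : R -> {RV P >-> R}).
Hypothesis fBm_B : two_sided_fBm H B.

Lemma two_sided_fBm_expectation_mul s t : ('E_P[B s \* B t] =
  (2^-1 * (`|s| `^ (2 * H) + `|t| `^ (2 * H) - `|t - s| `^ (2 * H)))%:E)%E.
Proof.
by case: fBm_B => _ EB0 covB; rewrite -covB covarianceC covariance_centered ?EB0.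
Qed.

Lemma two_sided_fBm_Lfun2 t : (B t : T -> R) \in Lfun P 2%:E.
Proof.
by apply: sqr_integrable_Lfun2; rewrite two_sided_fBm_expectation_mul ltry.
Qed.

Lemma gfBm_centered a b : centered_process (gfBm a b B).
Proof.
move=> t; have B1 x : (B x : T -> R) \in Lfun P 1.
  (* L2 lies in L1 because [P] has finite total mass. *)
  by apply: Lfun_subset12 (two_sided_fBm_Lfun2 x); rewrite fin_num_measure.
have [_ EB0 _] := fBm_B.
transitivity ('E_P[fun w => (a * B t%:num w + b * B (- t%:num) w)%R])%E => //.
by rewrite expectation_comb// !EB0 !mule0 adde0.
Qed.

(** Times of equal sign contribute [a ^+ 2 + b ^+ 2] with increment [t - s]; times of opposite sign
    contribute [2 * a * b] with increment [t + s]. Both the covariance and the variance formula come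
    from here. *)
Lemma gfBm_expectation_mul a b (s t : {nonneg R}) :
  ('E_P[gfBm a b B t \* gfBm a b B s] =
  (2^-1 * (a + b) ^+ 2 * (s%:num `^ (2 * H) + t%:num `^ (2 * H))
   - a * b * (t%:num + s%:num) `^ (2 * H)
   - (a ^+ 2 + b ^+ 2) / 2 * `|t%:num - s%:num| `^ (2 * H))%:E)%E.
Proof.
transitivity ('E_P[fun w => ((a * B t%:num w + b * B (- t%:num) w) *
   (a * B s%:num w + b * B (- s%:num) w))%R])%E => //.
rewrite expectation_mul_comb ?two_sided_fBm_Lfun2//.
rewrite !two_sided_fBm_expectation_mul !normrN.
(* The four increments agree, up to sign, with [t - s] or [t + s]; they are brought to these two
   forms before [field]. *)
rewrite -!EFinM -!EFinD !opprK -opprD normrN.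
rewrite [- _ + t%:num]addrC (distrC s%:num t%:num).
have ts0 : 0 <= t%:num + s%:num by rewrite addr_ge0.
rewrite (addrC s%:num) (ger0_norm ts0) !(ger0_norm (ge0 _)).
by congr EFin; field.
Qed.

End two_sided_fBm_moments.

Theorem lemma1 (R : realType) (d : measure_display) (T : measurableType d)
    (P : probability T R) (H a b : R) (B : R -> {RV P >-> R})
    (H_gt0 : 0 < H) (H_lt1 : H < 1) (ab_neq0 : (a, b) <> (0, 0))
    (fBm_B : two_sided_fBm H B) :
  [/\ gaussian_process (gfBm a b B) /\ centered_process (gfBm a b B),
      forall s t : {nonneg R},
        covariance P (gfBm a b B t) (gfBm a b B s) =
        (2^-1 * (a + b) ^+ 2 * (s%:num `^ (2 * H) + t%:num `^ (2 * H))
         - a * b * (t%:num + s%:num) `^ (2 * H)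
         - (a ^+ 2 + b ^+ 2) / 2 * `|t%:num - s%:num| `^ (2 * H))%:E &
      forall t : {nonneg R},
        'E_P[(fun w => (gfBm a b B t w ^+ 2)%R)]%E =
        ((a ^+ 2 + b ^+ 2 - (2 `^ (2 * H) - 2) * a * b)
         * t%:num `^ (2 * H))%:E].
Proof.
have EZ0 := gfBm_centered fBm_B a b.
split=> [|s t|t].
- split=> //; case: fBm_B => gB _ _.
  exact: (@gaussian_process_comb _ _ _ _ _ {nonneg R} B a b
    (fun t => t%:num) (fun t => - t%:num)).
- by rewrite covariance_centered// (gfBm_expectation_mul fBm_B).
- transitivity ('E_P[gfBm a b B t \* gfBm a b B t])%E => //.
  (* Zero to the power zero is 1, so the increment term vanishes only because [2 * H] is nonzero, by
     [H_gt0]. *)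
  rewrite (gfBm_expectation_mul fBm_B)// subrr normr0 powR0; last first.
    by rewrite gt_eqF// mulr_gt0.
  rewrite (_ : t%:num + t%:num = 2 * t%:num) ?powRM//; last by ring.
  by congr EFin; field.
Qed.
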